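(* Let $\mathfrak{q}=\mathfrak{l}\oplus\mathfrak{g}(1)\oplus\mathfrak{z}(\mathfrak{n})$ be a maximal parabolic subalgebra of quasi-Heisenberg type of one of the types $B_n(i)$ ($3\le i\le n$), $C_n(i)$ ($2\le i\le n-1$), $D_n(i)$ ($3\le i\le n-3$), $E_6(3)$, $E_6(5)$, $E_7(2)$, $E_7(6)$, $E_8(1)$, $F_4(4)$. Then the irreducible constituent $V(\xi_\gamma+\gamma)$ of $\mathfrak{l}_\gamma\otimes\mathfrak{z}(\mathfrak{n})$ is not special.
   Context: $\mathfrak{g}$ is a complex simple Lie algebra with Borel subalgebra $\mathfrak{b}\supset\mathfrak{h}$ (Cartan), roots $\Delta$, simple roots $\Pi$. ''$\mathfrak{q}$ is of type $\mathcal{T}(i)$'' means $\mathfrak{g}$ has type $\mathcal{T}$ and $\mathfrak{q}=\mathfrak{l}\oplus\mathfrak{n}$ is the standard maximal parabolic determined by $\alpha_\mathfrak{q}=\alpha_i$ (Bourbaki numbering): $\mathfrak{l}=\mathfrak{h}$ plus root spaces for roots in $\mathrm{span}(\Pi\setminus\{\alpha_\mathfrak{q}\})$, $\mathfrak{n}$ the remaining positive root spaces. Quasi-Heisenberg type: $[\mathfrak{n},[\mathfrak{n},\mathfrak{n}]]=0$, $\dim[\mathfrak{n},\mathfrak{n}]>1$. $\mathfrak{n}=\mathfrak{g}(1)\oplus\mathfrak{z}(\mathfrak{n})$, where $\mathfrak{g}(1)$ (resp. the center $\mathfrak{z}(\mathfrak{n})$) is the sum of the root spaces of roots with $\alpha_\mathfrak{q}$-coefficient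 $1$ (resp. $2$). $L$ is the Levi subgroup with Lie algebra $\mathfrak{l}$, acting by $\mathrm{Ad}$. $\Delta(W)$ denotes the roots whose root spaces lie in $W$. $\mu$ is the highest weight of the irreducible $L$-module $\mathfrak{g}(1)$ and $\gamma$ (the highest root) that of $\mathfrak{z}(\mathfrak{n})$. $\mathfrak{l}_\gamma$ is the simple ideal of $[\mathfrak{l},\mathfrak{l}]$ containing the root space of the unique simple root not orthogonal to $\gamma$; $\xi_\gamma$ is its highest root. $V(\nu)$ denotes an irreducible $L$-constituent with highest weight $\nu$ (a weight of $\mathfrak{h}$); it is special if $\nu\neq\gamma$ and there is $\epsilon\in\Delta(\mathfrak{g}(1))$ with $\nu=\mu+\epsilon$. *)

(* Defs.v *)
From mathcomp Require Export all_boot all_order all_algebra.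
From mathcomp Require Export reals complex.

Set Implicit Arguments.
Unset Strict Implicit.
Unset Printing Implicit Defensive.

Import GRing.Theory.
Local Open Scope ring_scope.

Record lieAlgebra (F : fieldType) := LieAlgebra {
  lie_space :> vectType F;
  bracket : lie_space -> lie_space -> lie_space;
  bracket_linear_r : forall x, linear (bracket x);
  bracket_linear_l : forall y, linear (fun x => bracket x y);
  bracket_alt : forall x, bracket x x = 0;
  bracket_jacobi : forall x y z,
    bracket x (bracket y z) + bracket y (bracket z x)
      + bracket z (bracket x y) = 0
}.

Section LieAlgebra.
Variables (F : fieldType) (g : lieAlgebra F).
Implicit Types (x y : g) (U V K I h b : {vspace g}).

Definition ad x : 'End(g) := linfun (bracket x).

Definition lie_prod U V : {vspace g} :=
  <<[seq bracket u v | u <- vbasis U, v <- vbasis V]>>%VS.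

Definition is_subalgebra K := (lie_prod K K <= K)%VS.

Definition is_ideal K I := (I <= K)%VS && (lie_prod K I <= I)%VS.

Definition is_simple K :=
  lie_prod K K <> 0%VS
  /\ forall I, is_ideal K I -> I = 0%VS \/ I = K.

Definition is_solvable K :=
  exists k : nat, iter k (fun U => lie_prod U U) K = 0%VS.

Definition is_borel b :=
  [/\ is_subalgebra b, is_solvable b
    & forall K, is_subalgebra K -> is_solvable K -> (b <= K)%VS -> K = b].

Definition ad_diagonalizable x :=
  exists2 X : seq g, basis_of fullv X
    & forall v, v \in X -> exists c : F, bracket x v = c *: v.

(* Cartan subalgebra of a complex semisimple Lie algebra: maximal abelian and
   acting by diagonalizable endomorphisms. *)
Definition is_cartan h :=
  [/\ forall x y, x \in h -> y \in h -> bracket x y = 0,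
      forall x, (forall y, y \in h -> bracket y x = 0) -> x \in h
    & forall x, x \in h -> ad_diagonalizable x].

Definition lie_center K : {vspace g} :=
  (K :&: \bigcap_(y <- vbasis K) lker (ad y))%VS.

Definition lfun_trace (f : 'End(g)) : F :=
  let e := vbasis {:g} in \sum_(i < \dim {:g}) coord e i (f e`_i).

Definition killing x y : F := lfun_trace (ad x \o ad y)%VF.

Definition weight h : vectType F := 'Hom(subvs_of h, F^o).

End LieAlgebra.

Section Roots.
Variables (F : fieldType) (g : lieAlgebra F) (h : {vspace g}).
Implicit Types (a b : weight h).

Definition weight_val a (s : subvs_of h) : F := (a : 'Hom(subvs_of h, F^o)) s.

(* The map h -> h^* induced by the Killing form; its inverse sends a to t_a. *)
Definition killing_flat : 'Hom(subvs_of h, 'Hom(subvs_of h, F^o)) :=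
  linfun (fun s : subvs_of h =>
    linfun (fun t : subvs_of h => killing (vsval s) (vsval t) : F^o)).

(* (a, b) = a(t_b) = killing t_a t_b *)
Definition wform a b : F := weight_val a ((killing_flat^-1)%VF b).

Definition cartan_int a b : F := 2%:R * wform a b / wform b b.

Definition rootspace a : {vspace g} :=
  (\bigcap_(s <- vbasis {:subvs_of h})
     lker (ad (vsval s) - weight_val a s *: \1%VF))%VS.

Definition is_root a := (a != 0) && (rootspace a != 0%VS).

(* The set of roots, listed; it is finite since g is finite dimensional. *)
Definition is_root_set (Delta : seq (weight h)) :=
  uniq Delta /\ Delta =i is_root.

Variables (Delta : seq (weight h)) (n : nat) (Pi : n.-tuple (weight h)).

Definition roots_in (W : {vspace g}) : seq (weight h) :=
  [seq a <- Delta | (rootspace a <= W)%VS].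

Definition nonneg_comb a := forall i, exists k : nat, coord Pi i a = k%:R.

(* Pi is the set of simple roots of the positive system Delta(b). *)
Definition is_simple_roots (b : {vspace g}) :=
  [/\ basis_of fullv Pi,
      {subset Pi <= Delta},
      forall a, a \in Delta -> nonneg_comb a \/ nonneg_comb (- a)
    & forall a, a \in Delta -> (a \in roots_in b <-> nonneg_comb a)].

Definition highest_root_in (W : {vspace g}) (a : weight h) :=
  a \in roots_in W /\ forall b, b \in roots_in W -> nonneg_comb (a - b).

End Roots.

Section Parabolic.
Variables (F : fieldType) (g : lieAlgebra F) (h b : {vspace g}).
Variables (Delta : seq (weight h)) (n : nat) (Pi : n.-tuple (weight h)).
Variable (q : 'I_n).

Definition in_levi_span (a : weight h) : bool :=
  a \in <<[seq tnth Pi j | j <- enum 'I_n & j != q]>>%VS.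

Definition levi : {vspace g} :=
  (h + \sum_(a <- Delta | in_levi_span a) rootspace a)%VS.

Definition nilradical : {vspace g} :=
  (\sum_(a <- roots_in Delta b | ~~ in_levi_span a) rootspace a)%VS.

Definition grade1 : {vspace g} :=
  (\sum_(a <- Delta | coord Pi q a == 1) rootspace a)%VS.

Definition quasi_heisenberg :=
  lie_prod nilradical (lie_prod nilradical nilradical) = 0%VS
  /\ (1 < \dim (lie_prod nilradical nilradical))%N.

End Parabolic.

(* g (x) g realized as square matrices of coordinates in vbasis {:g}, and, for
   subspaces U and V of g, U (x) V as a subspace of it. *)
Section Tensor.
Variables (F : fieldType) (g : lieAlgebra F).

Definition tensor_space : vectType F := 'M[F]_(\dim {:g}).

Definition tensor (x y : g) : tensor_space :=
  \matrix_(i, j) (coord (vbasis {:g}) i x * coord (vbasis {:g}) j y).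

Definition tensorv (U V : {vspace g}) : {vspace tensor_space} :=
  <<[seq tensor u v | u <- vbasis U, v <- vbasis V]>>%VS.

(* The linear action with x . (y (x) z) = [x, y] (x) z + y (x) [x, z]. *)
Definition tensor_act (x : g) (M : tensor_space) : tensor_space :=
  let e := vbasis {:g} in
  \sum_(i < \dim {:g}) \sum_(j < \dim {:g})
    M i j *: (tensor (bracket x e`_i) e`_j + tensor e`_i (bracket x e`_j)).

End Tensor.

Section Modules.
Variables (F : fieldType) (g : lieAlgebra F) (h b l : {vspace g}).
Variables (Delta : seq (weight h)).
Variables (X : vectType F) (act : g -> X -> X).
Implicit Types (W M N P : {vspace X}).

Definition is_submodule W := forall x w, x \in l -> w \in W -> act x w \in W.

(* M / N is an irreducible subquotient, i.e. composition factor, of the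
   l-module W. *)
Definition irr_constituent W M N :=
  [/\ (N <= M <= W)%VS, is_submodule M, is_submodule N, N <> M
    & forall P, is_submodule P -> (N <= P <= M)%VS -> P = N \/ P = M].

Definition highest_weight M N (nu : weight h) :=
  exists v, [/\ v \in M, v \notin N,
    forall s : subvs_of h, act (vsval s) v - weight_val nu s *: v \in N
  & forall a x, a \in roots_in Delta l -> a \in roots_in Delta b ->
      x \in rootspace a -> act x v \in N].

End Modules.

(* V(nu) is special. *)
Definition special (F : fieldType) (g : lieAlgebra F) (h : {vspace g})
    (Delta : seq (weight h)) (g1 : {vspace g}) (mu gamma nu : weight h) :=
  nu <> gamma /\ exists2 eps, eps \in roots_in Delta g1 & nu = mu + eps.

Inductive dynkin := TypeB of nat | TypeC of nat | TypeD of nat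
  | TypeE6 | TypeE7 | TypeE8 | TypeF4.

Definition dynkin_rank (T : dynkin) : nat :=
  match T with
  | TypeB n | TypeC n | TypeD n => n
  | TypeE6 => 6 | TypeE7 => 7 | TypeE8 => 8 | TypeF4 => 4
  end.

(* Edges {i, j} with i < j of the Dynkin diagram, Bourbaki numbering from 1. *)
Definition dynkin_edge (T : dynkin) (i j : nat) : bool :=
  match T with
  | TypeB _ | TypeC _ | TypeF4 => j == i.+1
  | TypeD n => (j == i.+1) && (j < n)%N || (i == n.-2) && (j == n)
  | TypeE6 | TypeE7 | TypeE8 =>
      (i == 1) && (j == 3) || (i == 2) && (j == 4)
      || (2 < i)%N && (j == i.+1)
  end.

(* Pairs (i, j) with <alpha_i, alpha_j^vee> = -2. *)
Definition dynkin_double (T : dynkin) (i j : nat) : bool :=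
  match T with
  | TypeB n => (i == n.-1) && (j == n)
  | TypeC n => (i == n) && (j == n.-1)
  | TypeF4 => (i == 2) && (j == 3)
  | _ => false
  end.

Definition cartan_entry (T : dynkin) (i j : nat) : int :=
  if i == j then 2%:Z
  else if dynkin_edge T (minn i j) (maxn i j)
  then if dynkin_double T i j then - 2%:Z else - 1%:Z
  else 0.

(* Shifted by one because the Bourbaki numbering starts from 1. *)
Definition has_type (F : fieldType) (g : lieAlgebra F) (h : {vspace g})
    (T : dynkin) (Pi : (dynkin_rank T).-tuple (weight h)) :=
  forall i j, cartan_int (tnth Pi i) (tnth Pi j)
              = (cartan_entry T i.+1 j.+1)%:~R.

Definition listed_type (T : dynkin) (i : nat) : bool :=
  match T with
  | TypeB n => (3 <= i <= n)%N
  | TypeC n => (2 <= i <= n - 1)%N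
  | TypeD n => (3 <= i <= n - 3)%N
  | TypeE6 => (i == 3) || (i == 5)
  | TypeE7 => (i == 2) || (i == 6)
  | TypeE8 => i == 1
  | TypeF4 => i == 4
  end.

(* Main.v *)
(* No case analysis is needed. Write <a, gamma> for 2(a, gamma)/(gamma, gamma).
   As gamma is the highest root, <a, gamma> <= 1 for every root a other than
   gamma, because otherwise the reflection of a in gamma would produce a root
   exceeding gamma. Since xi_gamma contains alpha_{j0}, the only simple root not
   orthogonal to gamma, <xi_gamma + gamma, gamma> >= 1 + 2, whereas
   <mu + eps, gamma> <= 1 + 1 because the roots mu and eps have
   alpha_q-coefficient 1, unlike gamma. For the existence of V(xi_gamma + gamma),
   the tensor of the two highest root vectors is killed by the positive root
   vectors of l, so it yields the constituent it generates.

   The Killing form cannot vanish, since otherwise all Cartan integers would be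
   0; its radical is an ideal, so it is nondegenerate (this replaces Cartan's
   criterion). The rest is the usual sl2 argument on root strings. *)
From HB Require Import structures.
Require Import Defs.
From mathcomp Require Import boolp zify ring.
Import Order.TTheory GRing.Theory Num.Theory.
Local Open Scope ring_scope.
Set Implicit Arguments.
Unset Strict Implicit.
Unset Printing Implicit Defensive.

(** * Sums and intersections of subspaces, and eigencomponents *)

Lemma subv_sum_seqP (F : fieldType) (V : vectType F) (I : eqType) (r : seq I)
    (P : pred I) (Us : I -> {vspace V}) (W : {vspace V}) :
  (forall i, i \in r -> P i -> (Us i <= W)%VS) ->
  (\sum_(i <- r | P i) Us i <= W)%VS.
Proof.
move=> sub; rewrite big_seq_cond; elim/big_rec: _ => [|i U /andP[ri Pi] sU].
  exact: sub0v.
by rewrite subv_add sub.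
Qed.

Lemma sumv_seq_sup (F : fieldType) (V : vectType F) (I : eqType) (r : seq I)
    (P : pred I) (Us : I -> {vspace V}) (i : I) :
  i \in r -> P i -> (Us i <= \sum_(j <- r | P j) Us j)%VS.
Proof.
move=> ri Pi; rewrite (big_rem i) //= Pi; exact: addvSl.
Qed.

Lemma memv_bigcap_seq (F : fieldType) (V : vectType F) (I : eqType)
    (r : seq I) (Us : I -> {vspace V}) (x : V) :
  reflect (forall i, i \in r -> x \in Us i) (x \in \bigcap_(i <- r) Us i)%VS.
Proof.
elim: r => [|i r IH]; first by rewrite big_nil memvf; apply: ReflectT.
rewrite big_cons memv_cap; apply: (iffP andP) => [[xi /IH xr] j|xr].
  by rewrite inE => /predU1P[->|/xr].
by split; [|apply/IH => j rj]; apply: xr; rewrite inE ?eqxx // rj orbT.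
Qed.

(* Applying A - c removes the component of eigenvalue c. *)
Lemma eigen_component_stable (F : fieldType) (V : vectType F) (A : 'End(V))
    (U : {vspace V}) (cs : seq F) (w : F -> V) :
  (forall u, u \in U -> A u \in U) -> uniq cs ->
  (forall c, c \in cs -> A (w c) = c *: w c) ->
  \sum_(c <- cs) w c \in U -> forall c, c \in cs -> w c \in U.
Proof.
move=> stabU; elim: cs w => [//|c0 cs IH] w /= /andP[c0cs ucs] eig.
rewrite big_cons => sumU.
have eig' c : c \in cs -> A (w c) = c *: w c.
  by move=> cin; apply: eig; rewrite inE cin orbT.
have inU c : c \in cs -> w c \in U.
  move=> cin.
  have := IH (fun c => (c - c0) *: w c) ucs _ _ c cin.
  rewrite rpredZeq subr_eq0; case: eqP => [ec|_] /=; first by rewrite -ec cin in c0cs.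
  apply=> [d din|]; first by rewrite linearZ /= eig' // !scalerA mulrC.
  have -> : \sum_(d <- cs) (d - c0) *: w d
      = A (w c0 + \sum_(j <- cs) w j) - c0 *: (w c0 + \sum_(j <- cs) w j).
    rewrite linearD /= eig ?mem_head // scalerDr opprD addrACA subrr add0r.
    rewrite linear_sum /= scaler_sumr -sumrB !big_seq.
    by apply: eq_bigr => d din; rewrite eig' // scalerBl.
  by rewrite rpredB ?stabU ?rpredZ.
move=> c; rewrite inE => /predU1P[->|]; last exact: inU.
have /rpredB/(_ (_ : \sum_(j <- cs) w j \in U)) := sumU; rewrite addrK; apply.
by rewrite big_seq; apply: rpred_sum => d /inU.
Qed.

Lemma linfunE (F : fieldType) (U V : vectType F) (f : U -> V) (u : U) :
  linear f -> linfun f u = f u.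
Proof.
move=> flin; pose fL := GRing.isLinear.Build F U V *:%R f flin.
pose f' : {linear U -> V} := HB.pack f fL.
exact: (lfunE f').
Qed.

Lemma coord_vbasis_neq0 (F : fieldType) (V : vectType F) (x : V) :
  x != 0 -> exists i, coord (vbasis {:V}) i x != 0.
Proof.
move=> nzx; apply/existsP; apply: contra_neqT nzx => /existsPn x0.
rewrite (coord_vbasis (memvf x)) big1 // => i _.
by have /negPn/eqP-> := x0 i; rewrite scale0r.
Qed.

(** * Brackets, traces and the Killing form *)

Section LieBasics.
Variables (F : fieldType) (g : lieAlgebra F).
Implicit Types (x y z : g) (U V W K I : {vspace g}).

Local Notation "[ x , y ]" := (bracket x y).

HB.instance Definition _ x :=
  GRing.isLinear.Build F g g *:%R (@bracket F g x) (@bracket_linear_r F g x).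

Lemma adE x y : ad x y = [x, y].
Proof. by rewrite lfunE. Qed.

Lemma bracketDl x y z : [x + y, z] = [x, z] + [y, z].
Proof. by have := bracket_linear_l z 1 x y; rewrite !scale1r. Qed.

Lemma bracket0l z : [0, z] = 0.
Proof. by apply: (addrI [0, z]); rewrite -bracketDl !addr0. Qed.

Lemma bracketZl c x z : [c *: x, z] = c *: [x, z].
Proof. by have := bracket_linear_l z c x 0; rewrite bracket0l !addr0. Qed.

Lemma bracketNC x y : [x, y] = - [y, x].
Proof.
apply/eqP; rewrite -addr_eq0; have := bracket_alt (x + y).
by rewrite bracketDl !linearD /= !bracket_alt addr0 add0r addrC => ->.
Qed.

Lemma bracket_suml (I : Type) (r : seq I) (P : pred I) (f : I -> g) z :
  [\sum_(i <- r | P i) f i, z] = \sum_(i <- r | P i) [f i, z].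
Proof.
by rewrite (big_morph (fun x => [x, z]) (fun x y => bracketDl x y z) (bracket0l z)).
Qed.

Lemma bracket_derivation x y z : [x, [y, z]] = [[x, y], z] + [y, [x, z]].
Proof.
have := bracket_jacobi x y z.
rewrite (bracketNC z x) (bracketNC z [x, y]) linearN /= => /eqP.
by rewrite -addrA -opprD subr_eq0 addrC => /eqP.
Qed.

Lemma lie_prodP U V W :
  reflect (forall u v, u \in U -> v \in V -> [u, v] \in W) (lie_prod U V <= W)%VS.
Proof.
apply: (iffP span_subvP) => [sub u v uU vV|sub _ /allpairsP[[u v] /= [uU vV ->]]].
  rewrite (coord_vbasis uU) (coord_vbasis vV) bracket_suml rpred_sum // => i _.
  rewrite linear_sum rpred_sum //= => j _; rewrite bracketZl linearZ /= !rpredZ //.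
  by apply: sub; apply/allpairsP; exists ((vbasis U)`_i, (vbasis V)`_j);
    rewrite !mem_nth ?size_tuple.
by apply: sub; apply: vbasis_mem.
Qed.

Lemma mem_lie_prod U V x y : x \in U -> y \in V -> [x, y] \in lie_prod U V.
Proof. exact/lie_prodP. Qed.

Lemma lie_centerP K x :
  reflect (x \in K /\ forall y, y \in K -> [y, x] = 0) (x \in lie_center K).
Proof.
rewrite memv_cap; apply: (iffP andP) => -[xK cx]; split=> //.
  move=> y /coord_vbasis ->; rewrite bracket_suml big1 // => i _.
  have /memv_bigcap_seq/(_ (vbasis K)`_i) := cx.
  by rewrite bracketZl memv_ker adE mem_nth ?size_tuple // => /(_ isT)/eqP->; rewrite scaler0.
by apply/memv_bigcap_seq => y /vbasis_mem /cx; rewrite memv_ker adE => ->.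
Qed.

(** [K, K] is an ideal of K, and simplicity excludes that it is 0. *)
Lemma is_simple_perfect K : is_subalgebra K -> is_simple K -> lie_prod K K = K.
Proof.
move=> subK [nab ideals]; case: (ideals (lie_prod K K)) => //.
rewrite /is_ideal [(_ <= K)%VS]subK /=; apply/lie_prodP => u v uK vK.
by apply: mem_lie_prod => //; apply: (subvP subK).
Qed.

Lemma lfun_traceD (f f' : 'End(g)) :
  lfun_trace (f + f') = lfun_trace f + lfun_trace f'.
Proof. by rewrite -big_split; apply: eq_bigr => i _; rewrite add_lfunE linearD. Qed.

Lemma lfun_traceZ c (f : 'End(g)) : lfun_trace (c *: f) = c * lfun_trace f.
Proof. by rewrite /lfun_trace mulr_sumr; apply: eq_bigr => i _; rewrite scale_lfunE linearZ. Qed.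

Lemma lfun_traceC (f f' : 'End(g)) : lfun_trace (f \o f')%VF = lfun_trace (f' \o f)%VF.
Proof.
(* In coordinates the trace of a composite is a double sum of products of matrix entries, and
   exchanging the two sums swaps the factors. *)
have trE (a b : 'End(g)) : lfun_trace (a \o b)%VF
   = \sum_(i < \dim {:g}) \sum_(j < \dim {:g}) coord (vbasis {:g}) j (b (vbasis {:g})`_i)
                  * coord (vbasis {:g}) i (a (vbasis {:g})`_j).
  apply: eq_bigr => i _; rewrite comp_lfunE {1}(coord_vbasis (memvf (b _))).
  by rewrite !linear_sum /=; apply: eq_bigr => j _; rewrite !linearZ.
rewrite !trE exchange_big; apply: eq_bigr => i _; apply: eq_bigr => j _.
by rewrite mulrC.
Qed.

Lemma ad_bracket x y : ad [x, y] = (ad x \o ad y)%VF - (ad y \o ad x)%VF.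
Proof.
apply/lfunP => z; rewrite add_lfunE opp_lfunE !comp_lfunE !adE.
by rewrite [ [x, [y, z]] ]bracket_derivation addrK.
Qed.

Lemma adD x y : ad (x + y) = ad x + ad y.
Proof. by apply/lfunP => z; rewrite add_lfunE !adE bracketDl. Qed.

Lemma adZ c x : ad (c *: x) = c *: ad x.
Proof. by apply/lfunP => z; rewrite scale_lfunE !adE bracketZl. Qed.

Lemma killingC x y : killing x y = killing y x.
Proof. exact: lfun_traceC. Qed.

Lemma killing_linear x : linear (killing x : g -> F^o).
Proof.
move=> c y z; rewrite /killing adD adZ comp_lfunDr -comp_lfunZr.
by rewrite lfun_traceD lfun_traceZ.
Qed.

HB.instance Definition _ x :=
  GRing.isLinear.Build F g F^o *:%R (killing x : g -> F^o) (killing_linear x).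

Lemma killingDl x y z : killing (x + y) z = killing x z + killing y z.
Proof. by rewrite ![killing _ z]killingC (linearD (killing z : g -> F^o)). Qed.

Lemma killingZl c x z : killing (c *: x) z = c * killing x z.
Proof. by rewrite ![killing _ z]killingC; apply: (linearZ_LR (killing z : g -> F^o)). Qed.

(** With X, Y, Z the adjoint maps, the XYZ terms of both sides agree, and tr(YXZ) = tr(XZY) by
    cyclicity. *)
Lemma killing_invariant x y z : killing [x, y] z = killing x [y, z].
Proof.
rewrite /killing !ad_bracket comp_lfunDl comp_lfunDr comp_lfunNl comp_lfunNr.
rewrite -!scaleN1r !lfun_traceD !lfun_traceZ -!comp_lfunA; congr (_ + _ * _).
by rewrite lfun_traceC comp_lfunA.
Qed.

Lemma killing_nondegenerate :
  is_simple (fullv : {vspace g}) -> (exists x y, killing x y != 0) ->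
  forall x, (forall y, killing x y = 0) -> x = 0.
Proof.
move=> [_ ideals] [a [b kab]] x kx.
pose rad : {vspace g} :=
  (\bigcap_(y <- vbasis {:g}) lker (linfun (killing y : g -> F^o)))%VS.
have radP z : reflect (forall y, killing y z = 0) (z \in rad).
  apply: (iffP (memv_bigcap_seq _ _ _)) => [kz y|kz y _]; last first.
    by rewrite memv_ker lfunE /= kz.
  rewrite (coord_vbasis (memvf y)) killingC (linear_sum (killing z : g -> F^o)) big1 //= => i _.
  have /(_ (vbasis {:g})`_i) := kz; rewrite mem_nth ?size_tuple // => /(_ isT).
  by rewrite memv_ker lfunE /= killingC => /eqP kz0; rewrite killingC killingZl killingC kz0 mulr0.
case: (ideals rad).
(* By invariance the pairing of y with [u, v] is that of [y, u] with v, which is 0 for v in the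
   radical. *)
- rewrite /is_ideal subvf /=; apply/lie_prodP => u v _ /radP kv.
  by apply/radP => y; rewrite -killing_invariant kv.
- move=> rad0; apply/eqP; rewrite -memv0 -rad0; apply/radP => y.
  by rewrite killingC.
- move=> radf; have /radP/(_ a) : b \in rad by rewrite radf memvf.
  by move/eqP; rewrite (negPf kab).
Qed.

End LieBasics.

(** * Weight spaces and simultaneous diagonalization *)

Section RootSpaces.
Variables (F : fieldType) (g : lieAlgebra F) (h : {vspace g}).
Implicit Types (a b : weight h) (s t : subvs_of h) (x y z v : g).

Local Notation "[ x , y ]" := (bracket x y).

Lemma weight_valD a b s : weight_val (a + b) s = weight_val a s + weight_val b s.
Proof. by rewrite /weight_val add_lfunE. Qed.

Lemma weight_valN a s : weight_val (- a) s = - weight_val a s.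
Proof. by rewrite /weight_val opp_lfunE. Qed.

Lemma weight_val0 s : weight_val (0 : weight h) s = 0.
Proof. by rewrite /weight_val zero_lfunE. Qed.

Lemma weight_valZ (k : F) a s : weight_val (k *: a) s = k * weight_val a s.
Proof. by rewrite /weight_val scale_lfunE. Qed.

Lemma weight_valMn a k s : weight_val (a *+ k) s = weight_val a s *+ k.
Proof.
by elim: k => [|k IH]; rewrite ?mulr0n ?weight_val0 // !mulrS weight_valD IH.
Qed.

Lemma weight_val_sum (I : Type) (r : seq I) (P : pred I) (f : I -> weight h) s :
  weight_val (\sum_(i <- r | P i) f i) s = \sum_(i <- r | P i) weight_val (f i) s.
Proof.
exact: (big_morph (fun a => weight_val a s) (fun a b => weight_valD a b s) (weight_val0 s)).
Qed.

Lemma rootspaceP a x :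
  reflect (forall s, [vsval s, x] = weight_val a s *: x) (x \in rootspace a).
Proof.
apply: (iffP (memv_bigcap_seq _ _ _)) => [ker s|eig s _]; last first.
  by rewrite memv_ker add_lfunE opp_lfunE scale_lfunE id_lfunE adE eig subrr.
rewrite (coord_vbasis (memvf s)) linear_sum bracket_suml /weight_val.
rewrite !linear_sum scaler_suml; apply: eq_bigr => i _.
rewrite !linearZ /= bracketZl -scalerA; congr (_ *: _); apply/eqP.
have := ker (vbasis {:subvs_of h})`_i; rewrite mem_nth ?size_tuple // => /(_ isT).
by rewrite memv_ker add_lfunE opp_lfunE scale_lfunE id_lfunE adE subr_eq0.
Qed.

Lemma bracket_rootspace a b x y :
  x \in rootspace a -> y \in rootspace b -> [x, y] \in rootspace (a + b).
Proof.
move=> /rootspaceP xa /rootspaceP yb; apply/rootspaceP => s.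
by rewrite bracket_derivation xa yb bracketZl linearZ /= -scalerDl weight_valD.
Qed.

Lemma ad_diagonalizable_decomp x v : ad_diagonalizable x ->
  exists (cs : seq F) (w : F -> g), [/\ uniq cs,
    forall c, c \in cs -> ad x (w c) = c *: w c & v = \sum_(c <- cs) w c].
Proof.
case=> X basisX eigX.
have /choice[ev evP] : forall u, exists c : F, u \in X -> [x, u] = c *: u.
  move=> u; case uX: (u \in X); last by exists 0.
  by have [c] := eigX u uX; exists c.
exists (undup (map ev X)).
(* The component for c collects the basis vectors of eigenvalue c; [undup] makes each basis vector
   count exactly once in the total. *)
exists (fun c => \sum_(i < size X | ev X`_i == c) coord (in_tuple X) i v *: X`_i).
split=> [|c _|]; first exact: undup_uniq.
  rewrite linear_sum scaler_sumr; apply: eq_bigr => i /eqP <-.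
  by rewrite linearZ /= adE evP ?mem_nth // !scalerA mulrC.
rewrite (exchange_big_dep xpredT) //= {1}(coord_basis (X := in_tuple X) basisX (memvf v)).
apply: eq_bigr => i _ /=.
rewrite big_mkcond (bigD1_seq (ev X`_i)) ?undup_uniq ?mem_undup ?map_f ?mem_nth //=.
by rewrite eqxx big1 ?addr0 // => c; rewrite eq_sym => /negPf->.
Qed.

Lemma killing_flatE s t : killing_flat h s t = killing (vsval s) (vsval t).
Proof.
have lin s' : linear (fun t : subvs_of h => killing (vsval s') (vsval t) : F^o).
  by move=> k t1 t2; rewrite (linearP vsval) killing_linear.
rewrite /killing_flat linfunE ?linfunE // => k s1 s2; apply/lfunP => t'.
rewrite add_lfunE scale_lfunE !linfunE // linearP.
by rewrite killingDl killingZl.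
Qed.

Hypothesis h_cartan : is_cartan h.

Lemma rootspace0 : rootspace (0 : weight h) = h.
Proof.
case: h_cartan => abel maxl _; apply/vspaceP => x; apply/rootspaceP/idP => [x0|xh s].
  by apply: maxl => y yh; rewrite -(vsprojK yh) x0 weight_val0 scale0r.
by rewrite weight_val0 scale0r abel ?subvsP.
Qed.

(** Simultaneous diagonalization of commuting operators, cast as an induction principle: every
    vector is a sum of common eigenvectors of the list. A vector that is already an eigenvector for
    the tail is split along the eigenvalues of the head. *)
Lemma common_eigenvector_ind (xs : seq g) (P : g -> Prop) : {subset xs <= h} ->
  P 0 -> (forall u v, P u -> P v -> P (u + v)) ->
  (forall y, (forall x, x \in xs -> exists c, [x, y] = c *: y) -> P y) ->
  forall v, P v.
Proof.
move=> xsh P0 PD; elim: xs xsh => [|x xs IH] xsh Peig; first by move=> v; exact: Peig.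
have [abel _ diag] := h_cartan.
apply: IH => [z zxs|y eigy]; first by apply: xsh; rewrite inE zxs orbT.
have xh : x \in h by apply: xsh; rewrite mem_head.
have [cs [w [ucs eigw def_y]]] := ad_diagonalizable_decomp y (diag x xh).
rewrite def_y big_seq; apply: big_ind => // c ccs; apply: Peig => z.
rewrite inE => /predU1P[->|zxs]; first by exists c; rewrite -adE eigw.
have zh : z \in h by apply: xsh; rewrite inE zxs orbT.
have [d yd] := eigy z zxs; exists d; apply/eqP.
(* The eigenspace of z for d is stable under ad x because x and z commute, so it contains the ad x
   components of each of its vectors. *)
pose U := lker (ad z - d *: \1%VF)%VF.
have UE u : (u \in U) = ([z, u] == d *: u).
  by rewrite memv_ker add_lfunE opp_lfunE scale_lfunE id_lfunE adE subr_eq0.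
rewrite -UE; apply: (eigen_component_stable (A := ad x)) ccs => // [u|].
  rewrite !UE adE bracket_derivation (abel z x) // bracket0l add0r => /eqP->.
  by rewrite linearZ.
by rewrite -def_y UE yd.
Qed.

(** The root space decomposition as an induction principle. The weight a ranges over all of h^*, so
    that a = 0 accounts for h. *)
Lemma rootspace_ind (P : g -> Prop) :
  P 0 -> (forall u v, P u -> P v -> P (u + v)) ->
  (forall a x, x \in rootspace a -> P x) -> forall v, P v.
Proof.
move=> P0 PD Proot.
apply: (@common_eigenvector_ind (vbasis h)) => // [x /vbasis_mem //|y eigy].
have [->//|nzy] := eqVneq y 0.
have [i nzi] := coord_vbasis_neq0 nzy.
have eigh x : x \in h -> exists c, [x, y] = c *: y.
  move=> xh; have /choice[ev evP] : forall i : 'I_(\dim h), exists c, [(vbasis h)`_i, y] = c *: y.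
    by move=> j; apply: eigy; rewrite mem_nth ?size_tuple.
  exists (\sum_j coord (vbasis h) j x * ev j).
  rewrite {1}(coord_vbasis xh) bracket_suml scaler_suml; apply: eq_bigr => j _.
  by rewrite bracketZl evP scalerA.
(* The i-th coordinate of y is nonzero, so this ratio is the eigenvalue of s on y; unlike a mere
   choice of eigenvalues it is visibly linear in s. *)
pose phi s : F^o := coord (vbasis {:g}) i [vsval s, y] / coord (vbasis {:g}) i y.
have phi_lin : linear phi.
  move=> k s t; rewrite /phi linearP bracketDl bracketZl linearP /=.
  by rewrite mulrDl -mulrA.
apply: (Proot (linfun phi : weight h)); apply/rootspaceP => s.
rewrite /weight_val linfunE // /phi.
by have [c ->] := eigh _ (subvsP s); rewrite linearZ /= mulfK.
Qed.

End RootSpaces.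

(** * Duality under the Killing form, root strings and reflections *)

Section RootTheory.
Variables (F : numFieldType) (g : lieAlgebra F) (h : {vspace g}).
Variable Delta : seq (weight h).
Implicit Types (a b c : weight h) (s t : subvs_of h) (x y z e f v w : g).

Local Notation "[ x , y ]" := (bracket x y).

Hypothesis h_cartan : is_cartan h.
Hypothesis killing_nondeg : forall x, (forall y, killing x y = 0) -> x = 0.
Hypothesis Delta_roots : is_root_set Delta.

Lemma mem_root a : (a \in Delta) = (a != 0) && (rootspace a != 0%VS).
Proof. by case: Delta_roots => _ ->. Qed.

Lemma rootspace_neq0 a x : x \in rootspace a -> x != 0 -> rootspace a != 0%VS.
Proof. by move=> xa; apply: contra_neq => a0; apply/eqP; rewrite -memv0 -a0. Qed.

Lemma root_vector a : a \in Delta -> exists2 x, x \in rootspace a & x != 0.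
Proof.
rewrite mem_root => /andP[_ nza]; exists (vpick (rootspace a)); first exact: memv_pick.
by rewrite vpick0.
Qed.

(** Invariance under s in h gives (a + b)(s) killing(x, y) = 0 for every s. *)
Lemma killing_rootspace_orth a b x y :
  x \in rootspace a -> y \in rootspace b -> a + b != 0 -> killing x y = 0.
Proof.
move=> /rootspaceP xa /rootspaceP yb nzab; apply/eqP; apply: contraNT nzab => nzk.
apply/eqP/lfunP => s; rewrite -[LHS]/(weight_val (a + b) s) -[RHS]/(weight_val 0 s).
have kxy : weight_val a s * killing x y = - (weight_val b s * killing x y).
  rewrite -killingZl -xa bracketNC -scaleN1r killingZl killing_invariant yb mulN1r.
  by rewrite killingC killingZl killingC.
by apply: (mulIf nzk); rewrite weight_val0 weight_valD mul0r mulrDl kxy addNr.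
Qed.

(** A vector of weight a is orthogonal to every weight space but that of - a; were it orthogonal to
    that one too, it would lie in the radical. *)
Lemma killing_rootspace_dual a x : x \in rootspace a -> x != 0 ->
  exists2 y, y \in rootspace (- a) & killing x y = 1.
Proof.
move=> xa nzx.
have [[y ya nzk]|no] := pselect (exists2 y, y \in rootspace (- a) & killing x y != 0).
  exists ((killing x y)^-1 *: y); first by apply: memvZ.
  by rewrite killingC killingZl [killing y x]killingC mulVf.
case/eqP: nzx; apply: killing_nondeg.
apply: (rootspace_ind h_cartan) => [|u v ku kv|b y yb].
- by rewrite (linear0 (killing x : g -> F^o)).
- by rewrite killingC killingDl killingC ku add0r killingC.
have [eb|nb] := eqVneq b (- a).
  by apply/eqP; apply: contra_notT no => nzk; exists y; rewrite -?eb.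
by apply: (killing_rootspace_orth xa yb); rewrite addrC addr_eq0.
Qed.

(** As h is the weight space of 0, it is orthogonal to all other weight spaces, so a vector of h
    orthogonal to h lies in the radical. *)
Lemma killing_cartan_nondeg s : (forall t, killing (vsval s) (vsval t) = 0) -> s = 0.
Proof.
move=> ks; apply: val_inj; apply: killing_nondeg.
have s0 : vsval s \in rootspace (0 : weight h) by rewrite rootspace0 // subvsP.
apply: (rootspace_ind h_cartan) => [|u v ku kv|b y yb].
- by rewrite (linear0 (killing _ : g -> F^o)).
- by rewrite killingC killingDl killingC ku add0r killingC.
have [eb|nb] := eqVneq b 0; last by rewrite (killing_rootspace_orth s0 yb) ?add0r.
by move: yb; rewrite eb rootspace0 // => yh; rewrite -(vsprojK yh).
Qed.

(** The element t_a of h that represents a under the Killing form. *)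
Definition killing_sharp a : subvs_of h := (killing_flat h)^-1%VF a.

Lemma killing_sharpE a s : killing (vsval (killing_sharp a)) (vsval s) = weight_val a s.
Proof.
rewrite -killing_flatE /killing_sharp limg_lfunVK //.
(* [killing_flat] is injective by nondegeneracy on h, hence onto because h and its dual have equal
   dimension; only then is [^-1] a true inverse. *)
have -> : limg (killing_flat h) = fullv; last exact: memvf.
apply/eqP; rewrite eqEdim subvf limg_dim_eq.
  by rewrite !dimvf -[X in (X <= _)%N]/(dim (subvs_of h) * 1)%N muln1 leqnn.
apply/eqP; rewrite -subv0 capfv; apply/subvP => s'; rewrite memv_ker => /eqP k0.
rewrite memv0; apply/eqP/killing_cartan_nondeg => t.
by rewrite -killing_flatE k0 zero_lfunE.
Qed.

Lemma wformE a b : wform a b = weight_val a (killing_sharp b).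
Proof. by []. Qed.

Lemma wformC a b : wform a b = wform b a.
Proof. by rewrite !wformE -!killing_sharpE killingC. Qed.

(** Both sides lie in h and, by invariance, pair equally with every element of h. *)
Lemma bracket_opp_rootspace a x y :
  x \in rootspace a -> y \in rootspace (- a) ->
  [x, y] = killing x y *: vsval (killing_sharp a).
Proof.
move=> xa ya; have xyh : [x, y] \in h.
  by rewrite -(rootspace0 h_cartan) -[0](subrr a) bracket_rootspace.
suff proj_xy : vsproj h [x, y] = killing x y *: killing_sharp a.
  by rewrite -(vsprojK xyh) proj_xy linearZ.
apply/eqP; rewrite -subr_eq0; apply/eqP.
apply: killing_cartan_nondeg => t.
have kxy : killing [x, y] (vsval t) = killing x y * weight_val a t.
  rewrite killing_invariant (bracketNC y) (rootspaceP _ _ ya) weight_valN scaleNr opprK.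
  by rewrite killingC killingZl killingC mulrC.
rewrite linearB linearZ /= vsprojK // killingDl -scaleN1r !killingZl kxy.
by rewrite killing_sharpE mulN1r mulrN subrr.
Qed.

Lemma mulrn_weight_inj a : a != 0 -> injective (GRing.natmul a).
Proof.
move=> nza m n /eqP; rewrite -!scaler_nat -subr_eq0 -scalerBl scaler_eq0 (negPf nza).
by rewrite orbF subr_eq0 eqr_nat => /eqP.
Qed.

Lemma rootspace_string_vanish a c : a != 0 -> exists n, rootspace (c + a *+ n) = 0%VS.
Proof.
move=> nza; apply: contrapT => /forallNP nz.
(* Pigeonhole: these [size Delta + 2] distinct weights cannot all lie among the [size Delta + 1]
   entries of [0 :: Delta]. *)
pose s := [seq c + a *+ n | n <- iota 0 (size Delta).+2].
have us : uniq s.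
  by rewrite map_inj_uniq ?iota_uniq // => m n /addrI /(mulrn_weight_inj nza).
have /(uniq_leq_size us) : {subset s <= 0 :: Delta}.
  move=> _ /mapP[n _ ->]; rewrite inE mem_root; case: eqP => //= _.
  exact/eqP/nz.
by rewrite size_map size_iota ltnn.
Qed.

Lemma iter_bracket_rootspace a c x v n :
  x \in rootspace a -> v \in rootspace c ->
  iter n (bracket x) v \in rootspace (c + a *+ n).
Proof.
move=> xa vc; elim: n => [|n IH]; first by rewrite addr0.
by rewrite iterS mulrS addrCA bracket_rootspace.
Qed.

(* The usual sl2 computation, with [e, f] = t not normalised so that a(t) = 0
   is not excluded: p and k are the lengths of the e-string through v and of
   the f-string through its top. *)
Lemma root_string a c e f t v : a != 0 ->
  e \in rootspace a -> f \in rootspace (- a) -> [e, f] = vsval t ->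
  v \in rootspace c -> v != 0 ->
  exists p k : nat,
    2%:R * (weight_val c t + weight_val a t *+ p) = weight_val a t *+ k
    /\ forall j, (j <= k)%N -> rootspace (c + a *+ p - a *+ j) != 0%VS.
Proof.
move=> nza ea fa eft vc nzv.
have top u b x (d : weight h) : b != 0 -> x \in rootspace b -> u \in rootspace d -> u != 0 ->
    exists n, iter n.+1 (bracket x) u = 0
      /\ forall j, (j <= n)%N -> iter j (bracket x) u != 0.
  move=> nzb xb ud nzu.
  have ex : exists n, iter n (bracket x) u == 0.
    have [n n0] := rootspace_string_vanish d nzb; exists n.
    by rewrite -memv0 -n0 iter_bracket_rootspace.
  case: (ex_minnP ex) => -[|n] /eqP n0 nmin; first by rewrite -n0 /= eqxx in nzu.
  exists n; split=> // j jn; apply/negP => /nmin; by rewrite ltnNge jn.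
have [p [wtop nzw]] := top v a e c nza ea vc nzv.
set w := iter p (bracket e) v in wtop nzw.
have wc : w \in rootspace (c + a *+ p) by apply: iter_bracket_rootspace.
have nza' : - a != 0 by rewrite oppr_eq0.
have [k [ubot nzu]] := top w (- a) f _ nza' fa wc (nzw p (leqnn p)).
exists p, k; have uc j : iter j (bracket f) w \in rootspace (c + a *+ p - a *+ j).
  by rewrite -mulNrn iter_bracket_rootspace.
split=> [|j jk]; last exact: rootspace_neq0 (uc j) (nzu j jk).
set m := weight_val c t + weight_val a t *+ p; set d := weight_val a t.
(* The sl2 relation e f^(j+1) w = (j+1)(m - jd/2) f^j w, doubled to avoid halves. At j = k the left
   side is 0, which forces 2m = kd. *)
have eu j : 2%:R *: [e, iter j.+1 (bracket f) w]
            = (j.+1%:R * (2%:R * m - j%:R * d)) *: iter j (bracket f) w.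
  elim: j => [|j IH].
    rewrite iterS bracket_derivation eft (rootspaceP _ _ wc) -iterS wtop linear0 addr0.
    by rewrite scalerA mul0r subr0 mul1r weight_valD weight_valMn.
  rewrite iterS bracket_derivation eft (rootspaceP _ _ (uc _)) scalerDr.
  have -> : 2%:R *: [f, [e, iter j.+1 (bracket f) w]]
      = (j.+1%:R * (2%:R * m - j%:R * d)) *: iter j.+1 (bracket f) w.
    by rewrite -(linearZ_LR (bracket f)) IH (linearZ_LR (bracket f)).
  rewrite scalerA -scalerDl.
  rewrite weight_valD weight_valN weight_valD !weight_valMn -/m -/d.
  congr (_ *: _); rewrite -[d *+ j.+1]mulr_natr -!natr1; ring.
have := eu k; rewrite ubot linear0 scaler0 => /esym/eqP.
rewrite scaler_eq0 (negPf (nzu k _)) // orbF mulf_eq0 pnatr_eq0 /= subr_eq0.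
by move/eqP->; rewrite mulr_natl.
Qed.

(** If (a, a) = 0, the string relation gives c(t_a) = 0 for every weight c, so t_a is central and ad
    t_a = 0. Then a(s) = killing(t_a, s) = 0 for all s in h, contrary to a being nonzero. *)
Lemma wform_root_neq0 a : a \in Delta -> wform a a != 0.
Proof.
move=> aD; have [e ea nze] := root_vector aD.
move: (aD); rewrite mem_root => /andP[nza _].
have [f fa kef] := killing_rootspace_dual ea nze.
have eft := bracket_opp_rootspace ea fa; rewrite kef scale1r in eft.
apply/eqP => a0; rewrite wformE in a0.
have central : forall x, [vsval (killing_sharp a), x] = 0.
  apply: (rootspace_ind h_cartan) => [|u v ku kv|c v vc]; first exact: linear0.
    by rewrite linearD /= ku kv addr0.
  have [->|nzv] := eqVneq v 0; first exact: linear0.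
  have [p [k [+ _]]] := root_string nza ea fa eft vc nzv.
  rewrite a0 !mul0rn addr0 => /eqP; rewrite mulf_eq0 pnatr_eq0 /= => /eqP c0.
  by rewrite (rootspaceP _ _ vc) c0 scale0r.
case/eqP: nza; apply/lfunP => s; rewrite -[LHS]/(weight_val a s) zero_lfunE.
rewrite -killing_sharpE killingC /killing.
have -> : ad (vsval (killing_sharp a)) = 0.
  by apply/lfunP => x; rewrite adE central zero_lfunE.
by rewrite comp_lfun0r -(scale0r 0) lfun_traceZ mul0r.
Qed.

Lemma root_opp a : a \in Delta -> - a \in Delta.
Proof.
move=> aD; have [e ea nze] := root_vector aD.
have [f fa kef] := killing_rootspace_dual ea nze.
move: aD; rewrite !mem_root oppr_eq0 => /andP[-> _] /=; apply: rootspace_neq0 fa _.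
by apply: contra_eq_neq kef => ->; rewrite (linear0 (killing e : g -> F^o)) eq_sym oner_eq0.
Qed.

Lemma wformD a b c : wform (a + b) c = wform a c + wform b c.
Proof. by rewrite !wformE weight_valD. Qed.

Lemma wformN a c : wform (- a) c = - wform a c.
Proof. by rewrite !wformE weight_valN. Qed.

Lemma wformNr a c : wform c (- a) = - wform c a.
Proof. by rewrite wformC wformN wformC. Qed.

Lemma wformZ k a c : wform (k *: a) c = k * wform a c.
Proof. by rewrite !wformE weight_valZ. Qed.

Lemma wform_sum (I : Type) (r : seq I) (P : pred I) (w : I -> weight h) c :
  wform (\sum_(i <- r | P i) w i) c = \sum_(i <- r | P i) wform (w i) c.
Proof. by rewrite !wformE weight_val_sum. Qed.

(** The integer k - 2p is the Cartan integer of c against a, so the second clause is the reflection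
    of c when that integer is nonnegative. The other sign follows by passing to - a. *)
Lemma root_string_half a c : a \in Delta -> c \in Delta ->
  exists p k : nat, 2%:R * wform c a = (k%:R - 2%:R * p%:R) * wform a a
    /\ ((2 * p <= k)%N -> c - a *+ (k - 2 * p) \in Delta).
Proof.
move=> aD cD; have [e ea nze] := root_vector aD; have [v vc nzv] := root_vector cD.
move: (aD) (cD); rewrite !mem_root => /andP[nza _] /andP[nzc _].
have [f fa kef] := killing_rootspace_dual ea nze.
have eft := bracket_opp_rootspace ea fa; rewrite kef scale1r in eft.
have [p [k [+ nzs]]] := root_string nza ea fa eft vc nzv.
rewrite -!wformE => ck.
have E : 2%:R * wform c a = (k%:R - 2%:R * p%:R) * wform a a.
  apply: (addIr (2%:R * (wform a a *+ p))); rewrite -mulrDr ck.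
  rewrite -[wform a a *+ k]mulr_natr -[wform a a *+ p]mulr_natr; ring.
exists p, k; split=> // pk; rewrite mem_root; apply/andP; split.
  (* If c = ma with m = k - 2p, the relation [E] reads 2m = m after division by (a, a), so m = 0 and
     c = 0. *)
  apply: contra_neq nzc => /eqP; rewrite subr_eq0 => /eqP c_a.
  move: E; rewrite c_a -scaler_nat wformZ natrB // natrM => /eqP.
  rewrite mulrA (inj_eq (mulIf (wform_root_neq0 aD))) -subr_eq0 mulr_natl mulr2n addrK.
  by move/eqP->; rewrite scale0r.
(* In the string descending from c + pa, the root c has index p and its mirror image c - (k - 2p)a
   has index k - p. *)
have := nzs (k - p)%N (leq_subr _ _).
have -> : (k - p = (k - 2 * p) + p)%N by lia.
by rewrite mulrnDr opprD addrA [_ + a *+ p - _]addrAC addrK.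
Qed.

Lemma root_reflection a c : a \in Delta -> c \in Delta ->
  exists m : nat,
    (2%:R * wform c a = m%:R * wform a a /\ c - a *+ m \in Delta)
    \/ (2%:R * wform c a = - m%:R * wform a a /\ c + a *+ m \in Delta).
Proof.
move=> aD cD; have [p [k [E str]]] := root_string_half aD cD.
have [pk|kp] := leqP (2 * p) k.
  by exists (k - 2 * p)%N; left; rewrite natrB // natrM; split=> //; apply: str.
(* For a negative Cartan integer the string along - a is used. Its integer k' - 2p' is the opposite
   one, an identity carried from the field to natural numbers by [E']. *)
have [p' [k' [+ str']]] := root_string_half (root_opp aD) cD.
rewrite wformN !wformNr opprK mulrN E => EF.
have E' : (k' + k = 2 * p' + 2 * p)%N.
  apply/eqP; rewrite -(eqr_nat F) (natrD _ k') (natrD _ (2 * p')) !natrM -subr_eq0.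
  rewrite -(mulIr_eq0 _ (mulIf (wform_root_neq0 aD))).
  have -> : (k'%:R + k%:R - (2%:R * p'%:R + 2%:R * p%:R)) * wform a a
     = (k'%:R - 2%:R * p'%:R) * wform a a + (k%:R - 2%:R * p%:R) * wform a a by ring.
  by rewrite -EF addNr.
exists (k' - 2 * p')%N; right; split; last first.
  by rewrite -[_ *+ _]opprK -mulNrn; apply: str'; lia.
rewrite natrB ?natrM; last lia.
have /(congr1 (fun n => n%:R : F)) := E'; rewrite (natrD _ k') (natrD _ (2 * p')) !natrM => E2.
have -> : k%:R - 2%:R * p%:R = k'%:R + k%:R - (2%:R * p%:R + k'%:R) :> F by ring.
by rewrite E2; congr (_ * _); ring.
Qed.

Lemma cartan_intD a b c : cartan_int (a + b) c = cartan_int a c + cartan_int b c.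
Proof. by rewrite /cartan_int wformD mulrDr mulrDl. Qed.

Lemma cartan_int_sum n (k : 'I_n -> F) (w : 'I_n -> weight h) c :
  cartan_int (\sum_i k i *: w i) c = \sum_i k i * cartan_int (w i) c.
Proof.
rewrite /cartan_int wform_sum mulr_sumr mulr_suml; apply: eq_bigr => i _.
by rewrite wformZ mulrCA !mulrA.
Qed.

Lemma cartan_int_reflection a c : a \in Delta -> c \in Delta ->
  exists m : nat, (cartan_int c a = m%:R /\ c - a *+ m \in Delta)
               \/ (cartan_int c a = - m%:R /\ c + a *+ m \in Delta).
Proof.
move=> aD cD; have nz := wform_root_neq0 aD.
have [m [[E r]|[E r]]] := root_reflection aD cD; exists m; [left|right];
  by rewrite /cartan_int E mulfK.
Qed.

(** Weight 0 is adjoined to the roots so that h is included. The Levi subalgebra, g(1) and the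
    nilradical all take this form, and their bracket relations become statements about weights. *)
Definition weight_sum (Q : pred (weight h)) : {vspace g} :=
  (\sum_(a <- 0%R :: Delta | Q a) rootspace a)%VS.

Lemma weight_sum_le (Q : pred (weight h)) (W : {vspace g}) :
  (forall a x, a \in 0 :: Delta -> Q a -> x \in rootspace a -> x \in W) ->
  (weight_sum Q <= W)%VS.
Proof.
by move=> sub; apply: subv_sum_seqP => a aD Qa; apply/subvP => x; apply: sub.
Qed.

Lemma weight_of_vector a x : x \in rootspace a -> x != 0 -> a \in 0 :: Delta.
Proof.
move=> xa nzx; rewrite inE mem_root; case: eqP => //= _.
exact: rootspace_neq0 xa nzx.
Qed.

Lemma mem_weight_sum (Q : pred (weight h)) a x :
  Q a -> x \in rootspace a -> x \in weight_sum Q.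
Proof.
move=> Qa xa; have [->|nzx] := eqVneq x 0; first exact: mem0v.
apply: (subvP _ _ xa); apply: sumv_seq_sup => //; exact: weight_of_vector xa nzx.
Qed.

(** This plays the part of directness of the sum: a vector of weight - a dual to x is orthogonal to
    all weight spaces other than that of a, hence to the whole sum if Q fails at a. *)
Lemma weight_sum_weight (Q : pred (weight h)) a x :
  x \in rootspace a -> x != 0 -> x \in weight_sum Q -> Q a.
Proof.
move=> xa nzx xQ; have [y ya kxy] := killing_rootspace_dual xa nzx.
apply: contraT => nQa.
have : x \in lker (linfun (killing y : g -> F^o)).
  apply: (subvP _ _ xQ); apply: weight_sum_le => b z bD Qb zb.
  rewrite memv_ker lfunE /= killingC (killing_rootspace_orth zb ya) // subr_eq0.
  by apply: contraNneq nQa => <-.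
by rewrite memv_ker lfunE /= killingC kxy oner_eq0.
Qed.

Lemma bracket_weight_sum (Q1 Q2 Q3 : pred (weight h)) x y :
  (forall a b, a \in 0 :: Delta -> b \in 0 :: Delta -> a + b \in 0 :: Delta ->
     Q1 a -> Q2 b -> Q3 (a + b)) ->
  x \in weight_sum Q1 -> y \in weight_sum Q2 -> [x, y] \in weight_sum Q3.
Proof.
move=> Q123 xQ yQ.
(* As preimages under ad z are subspaces, the claim can be checked on weight vectors in one
   argument, then in the other. *)
pose W z : {vspace g} := (ad z @^-1: weight_sum Q3)%VS.
have WE z u : (u \in W z) = ([z, u] \in weight_sum Q3).
  by rewrite -memv_preim adE.
rewrite -WE; apply: (subvP _ _ yQ); apply: weight_sum_le => b y' bD Qb yb.
rewrite WE bracketNC rpredN -WE; apply: (subvP _ _ xQ).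
apply: weight_sum_le => a x' aD Qa xa; rewrite WE bracketNC rpredN.
have [->|nz] := eqVneq [x', y'] 0; first exact: mem0v.
have xy := bracket_rootspace xa yb.
exact: mem_weight_sum (Q123 _ _ aD bD (weight_of_vector xy nz) Qa Qb) xy.
Qed.

(** * Coordinates in the simple roots *)

Section SimpleRoots.
Variables (bo : {vspace g}) (n : nat) (Pi : n.-tuple (weight h)).
Hypothesis Pi_simple : is_simple_roots Delta Pi bo.

Lemma simple_root_mem i : tnth Pi i \in Delta.
Proof. by case: Pi_simple => _ sub _ _; apply: sub; apply: mem_tnth. Qed.

Lemma coord_simple i j : coord Pi i (tnth Pi j) = (i == j)%:R.
Proof.
case: Pi_simple => /basis_free freePi _ _ _.
by rewrite (tnth_nth 0) coord_free // eq_sym.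
Qed.

Lemma simple_decomp a : a = \sum_i coord Pi i a *: tnth Pi i.
Proof.
case: Pi_simple => basisPi _ _ _; rewrite {1}(coord_basis basisPi (memvf a)).
by apply: eq_bigr => i _; rewrite -tnth_nth.
Qed.

Lemma coord_simple_inj a b : (forall i, coord Pi i a = coord Pi i b) -> a = b.
Proof.
by move=> ab; rewrite [a]simple_decomp [b]simple_decomp; apply: eq_bigr => i _; rewrite ab.
Qed.

Lemma nonneg_coord a i : nonneg_comb Pi a -> 0 <= coord Pi i a.
Proof. by move=> /(_ i)[k ->]; apply: ler0n. Qed.

Lemma positive_rootP a : reflect (a \in Delta /\ nonneg_comb Pi a) (a \in roots_in Delta bo).
Proof.
case: Pi_simple => _ _ _ pos; apply: (iffP idP) => [ab|[aD nna]]; last exact/pos.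
have aD : a \in Delta by move: ab; rewrite mem_filter => /andP[].
by split=> //; apply/pos.
Qed.

Lemma in_levi_spanE q a : in_levi_span Pi q a = (coord Pi q a == 0).
Proof.
apply/idP/eqP => [|a0]; last first.
  rewrite /in_levi_span [a]simple_decomp rpred_sum // => i _.
  have [->|iq] := eqVneq i q; first by rewrite a0 scale0r mem0v.
  by rewrite memvZ // memv_span // map_f // mem_filter iq mem_enum.
move=> aL; have : a \in lker (linfun (coord Pi q : weight h -> F^o)).
  apply: (subvP _ _ aL); apply/span_subvP => u /mapP[j]; rewrite mem_filter => /andP[jq _] ->.
  by rewrite memv_ker lfunE /= coord_simple [q == j]eq_sym (negPf jq).
by rewrite memv_ker lfunE => /eqP.
Qed.

Lemma levi_weight_sum q : levi Delta Pi q = weight_sum (fun a => coord Pi q a == 0).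
Proof.
rewrite /levi /weight_sum big_cons linear0 eqxx rootspace0 //; congr (_ + _)%VS.
by apply: eq_bigl => a; rewrite in_levi_spanE.
Qed.

Lemma zero_not_root : 0 \notin Delta.
Proof. by rewrite mem_root eqxx. Qed.

Lemma grade1_weight_sum q : grade1 Delta Pi q = weight_sum (fun a => coord Pi q a == 1).
Proof. by rewrite /weight_sum big_cons linear0 eq_sym oner_eq0. Qed.

Lemma nilradical_weight_sum q : nilradical bo Delta Pi q
  = weight_sum (fun a => (a \in roots_in Delta bo) && (coord Pi q a != 0)).
Proof.
rewrite /weight_sum big_cons linear0 eqxx andbF /nilradical big_filter_cond.
rewrite big_seq_cond [RHS]big_seq_cond; apply: eq_bigl => a.
by rewrite in_levi_spanE mem_filter; case: (a \in Delta); rewrite ?andbT.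
Qed.

(** * The highest root and Cartan integers against it *)

Section HighestRoot.
Variable gamma : weight h.
Hypothesis gamma_highest : highest_root_in Delta Pi fullv gamma.

Lemma highest_root_mem : gamma \in Delta.
Proof. by case: gamma_highest; rewrite mem_filter => /andP[]. Qed.

Lemma coord_le_highest a i : a \in Delta -> coord Pi i a <= coord Pi i gamma.
Proof.
move=> aD; have [_ /(_ a)] := gamma_highest; rewrite mem_filter subvf aD => /(_ isT).
by move/(nonneg_coord i); rewrite linearB subr_ge0.
Qed.

Lemma coord_highest_ge1 i : 1 <= coord Pi i gamma.
Proof. by have := coord_le_highest i (simple_root_mem i); rewrite coord_simple eqxx. Qed.

Lemma coord_highest_gt0 i : 0 < coord Pi i gamma.
Proof. exact: lt_le_trans ltr01 (coord_highest_ge1 i). Qed.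

(** The index i witnesses that there is a simple root; the coordinate of gamma there is positive, so
    - gamma is not a nonnegative combination. *)
Lemma highest_positive (i : 'I_n) : gamma \in roots_in Delta bo.
Proof.
apply/positive_rootP; split; first exact: highest_root_mem.
case: Pi_simple => _ _ /(_ _ highest_root_mem)[//|/(nonneg_coord i) c_ge0] _.
by move: c_ge0; rewrite linearN oppr_ge0 => /(lt_le_trans (coord_highest_gt0 i)); rewrite ltxx.
Qed.

Lemma highest_bracket0 (i : 'I_n) a x y : a \in roots_in Delta bo ->
  y \in rootspace a -> x \in rootspace gamma -> [y, x] = 0.
Proof.
move=> /positive_rootP[aD nna] ya xc; apply: contraTeq aD => nz.
have := weight_of_vector (bracket_rootspace ya xc) nz; rewrite inE => /predU1P[ac|acD].
  (* The sum a + gamma cannot be 0, since its i-th coordinate is positive. *)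
  have := coord_highest_gt0 i; have /eqP := congr1 (coord Pi i) ac.
  rewrite linearD linear0 /= addr_eq0 => /eqP/esym/eqP; rewrite eqr_oppLR => /eqP->.
  by rewrite oppr_gt0 le_gtF // nonneg_coord.
(* Otherwise a + gamma is a root bounded by gamma, which leaves no positive coordinate for a. *)
suff -> : a = 0 by apply: zero_not_root.
apply: coord_simple_inj => j; rewrite linear0; apply/eqP; rewrite eq_le nonneg_coord // andbT.
by have := coord_le_highest j acD; rewrite linearD gerDr.
Qed.

(* If 2(a,gamma)/(gamma,gamma) = m >= 2, then m gamma - a is a root, hence at
   most gamma, so that gamma <= (m - 1) gamma <= a. *)
Lemma cartan_int_highest_le1 a : a \in Delta -> a != gamma -> cartan_int a gamma <= 1.
Proof.
move=> aD ac; have [m [[-> r]|[-> _]]] := cartan_int_reflection highest_root_mem aD; last first.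
  by rewrite (@le_trans _ _ 0) // oppr_le0 ler0n.
rewrite (ler_nat _ m 1); apply: contraR ac; rewrite -ltnNge => m2; apply/eqP.
apply: coord_simple_inj => j; apply/eqP; rewrite eq_le coord_le_highest //=.
have := coord_le_highest j (root_opp r).
rewrite opprB linearB linearMn /= lerBlDr => cm.
have : coord Pi j gamma *+ 2 <= coord Pi j gamma *+ m by rewrite ler_pMn2l ?coord_highest_gt0.
by move/le_trans/(_ cm); rewrite mulr2n lerD2l.
Qed.

(** A negative value - m would make alpha_j + m gamma a root, and its j-th coordinate exceeds that
    of gamma. *)
Lemma cartan_int_simple_highest_ge1 j :
  wform gamma (tnth Pi j) != 0 -> 1 <= cartan_int (tnth Pi j) gamma.
Proof.
move=> nz; have jD := simple_root_mem j.
have nzc : cartan_int (tnth Pi j) gamma != 0.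
  rewrite /cartan_int !mulf_neq0 ?pnatr_eq0 ?invr_eq0 // ?wform_root_neq0 ?highest_root_mem //.
  by rewrite wformC.
have [[|m] [[E r]|[E r]]] := cartan_int_reflection highest_root_mem jD.
- by rewrite E eqxx in nzc.
- by rewrite E oppr0 eqxx in nzc.
- by rewrite E ler1n.
have := coord_le_highest j r; rewrite linearD linearMn /= coord_simple eqxx mulrS addrCA.
rewrite gerDl => le0.
have : 0 < 1 + coord Pi j gamma *+ m by rewrite ltr_pwDl // mulrn_wge0 // ltW // coord_highest_gt0.
by move/lt_le_trans/(_ le0); rewrite ltxx.
Qed.

(** In the expansion of xi in simple roots only the term of alpha_j pairs nontrivially with gamma,
    and both of its factors are at least 1. *)
Lemma cartan_int_highest_ge1 j xi :
  (forall i, wform gamma (tnth Pi i) <> 0 -> i = j) ->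
  wform gamma (tnth Pi j) <> 0 -> 1 <= coord Pi j xi -> 1 <= cartan_int xi gamma.
Proof.
move=> uniq_j /eqP nz xi1; rewrite [xi]simple_decomp cartan_int_sum (bigD1 j) //= big1.
  by rewrite addr0 mulr_ege1 // cartan_int_simple_highest_ge1.
move=> i ij; rewrite /cartan_int wformC.
have [->|/eqP/uniq_j ei] := eqVneq (wform gamma (tnth Pi i)) 0.
  by rewrite mulr0 mul0r mulr0.
by rewrite ei eqxx in ij.
Qed.

Lemma highest_root_sum_neq j xi mu eps :
  (forall i, wform gamma (tnth Pi i) <> 0 -> i = j) ->
  wform gamma (tnth Pi j) <> 0 -> 1 <= coord Pi j xi ->
  mu \in Delta -> eps \in Delta -> mu != gamma -> eps != gamma ->
  xi + gamma != mu + eps.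
Proof.
move=> uniq_j nz xi1 muD epsD muc epsc.
apply/eqP => /(congr1 (fun a => cartan_int a gamma)); rewrite !cartan_intD => E.
have cc : cartan_int gamma gamma = 2.
  by rewrite /cartan_int mulfK // wform_root_neq0 // highest_root_mem.
have := lerD (cartan_int_highest_le1 muD muc) (cartan_int_highest_le1 epsD epsc).
rewrite -E cc => le2; have := cartan_int_highest_ge1 uniq_j nz xi1.
rewrite -(lerD2r 2) => /le_trans/(_ le2).
by rewrite -(natrD _ 1 2) -(natrD _ 1 1) ler_nat.
Qed.

Lemma highest_rootspace_center q :
  (rootspace gamma <= lie_center (nilradical bo Delta Pi q))%VS.
Proof.
apply/subvP => x xc; apply/lie_centerP; split.
  rewrite nilradical_weight_sum; apply: mem_weight_sum xc.
  by rewrite highest_positive // gt_eqF // coord_highest_gt0.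
move=> y yn; rewrite bracketNC; apply/eqP; rewrite oppr_eq0 -adE -memv_ker.
apply: (subvP _ _ yn); rewrite nilradical_weight_sum; apply: weight_sum_le => a z _ /andP[ab _] za.
by rewrite memv_ker adE bracketNC (highest_bracket0 q ab za xc) oppr0.
Qed.

End HighestRoot.

(** * The Levi subalgebra acting on the nilradical and on its simple ideal *)

Section Levi.
Variable q : 'I_n.
Local Notation l := (levi Delta Pi q).
Local Notation nil := (nilradical bo Delta Pi q).

Lemma bracket_levi x y : x \in l -> y \in l -> [x, y] \in l.
Proof.
rewrite levi_weight_sum; apply: bracket_weight_sum => a b _ _ _ /eqP a0 /eqP b0.
by rewrite linearD /= a0 b0 addr0.
Qed.

(** Adding a weight of l leaves the alpha_q-coefficient unchanged, and one positive coefficient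
    decides that a root is positive. *)
Lemma bracket_levi_nilradical x y : x \in l -> y \in nil -> [x, y] \in nil.
Proof.
rewrite levi_weight_sum nilradical_weight_sum.
apply: bracket_weight_sum => a b _ _ abD /eqP a0 /andP[/positive_rootP[bD nnb] b0].
have qE : coord Pi q (a + b) = coord Pi q b by rewrite linearD /= a0 add0r.
rewrite qE b0 andbT; apply/positive_rootP.
have {}abD : a + b \in Delta.
  move: abD; rewrite inE => /predU1P[ab0|//].
  by rewrite -qE ab0 linear0 eqxx in b0.
split=> //; case: Pi_simple => _ _ /(_ _ abD)[//|/(nonneg_coord q) b_ge0] _.
move: b_ge0; rewrite linearN /= qE oppr_ge0 => b_le0.
by case/eqP: b0; apply/eqP; rewrite eq_le b_le0 nonneg_coord.
Qed.

Lemma bracket_levi_center x z :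
  x \in l -> z \in lie_center nil -> [x, z] \in lie_center nil.
Proof.
move=> xl /lie_centerP[zn cz]; apply/lie_centerP; split; first exact: bracket_levi_nilradical.
move=> y yn; rewrite bracket_derivation (cz y) // linear0 addr0.
by rewrite cz // bracketNC rpredN bracket_levi_nilradical.
Qed.

Variable k : {vspace g}.
Hypothesis k_ideal : is_ideal (lie_prod l l) k.
Hypothesis k_simple : is_simple k.

Lemma ideal_sub_levi : (k <= l)%VS.
Proof.
case/andP: k_ideal => kll _; apply: subv_trans kll _; apply/lie_prodP.
exact: bracket_levi.
Qed.

(* k is only an ideal of [l, l], but k = [k, k] and [l, k] lies in [l, l]. *)
Lemma bracket_levi_ideal x y : x \in l -> y \in k -> [x, y] \in k.
Proof.
move=> xl; case/andP: (k_ideal) => kll /lie_prodP idk.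
have kP := subvP ideal_sub_levi.
have subk : is_subalgebra k by apply/lie_prodP => u v uk vk; apply: idk (subvP kll _ uk) vk.
rewrite -{1}(is_simple_perfect subk k_simple) => yk.
suff : y \in (ad x @^-1: k)%VS by rewrite -memv_preim adE.
apply: (subvP _ _ yk); apply/lie_prodP => u v uk vk.
rewrite -memv_preim adE bracket_derivation rpredD //.
  by apply: idk => //; apply: mem_lie_prod => //; apply: kP.
by rewrite bracketNC rpredN; apply: idk => //; apply: mem_lie_prod => //; apply: kP.
Qed.

(** Bracketing y with a dual vector puts t_a in k, and t_a acts on the whole root space by the
    nonzero scalar (a, a). *)
Lemma rootspace_sub_ideal a y : a \in Delta ->
  y \in rootspace a -> y != 0 -> y \in k -> (rootspace a <= k)%VS.
Proof.
move=> aD ya nzy yk; have [f fa kyf] := killing_rootspace_dual ya nzy.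
have yl : y \in l := subvP ideal_sub_levi y yk.
have inl b z : coord Pi q b = 0 -> z \in rootspace b -> z \in l.
  by move=> b0 zb; rewrite levi_weight_sum; apply: mem_weight_sum zb; apply/eqP.
have a0 : coord Pi q a = 0.
  by move: yl; rewrite levi_weight_sum => /(weight_sum_weight ya nzy)/eqP.
have fl : f \in l by apply: inl fa; rewrite linearN /= a0 oppr0.
have tk : vsval (killing_sharp a) \in k.
  rewrite -[vsval _]scale1r -kyf -(bracket_opp_rootspace ya fa) bracketNC rpredN.
  exact: bracket_levi_ideal.
apply/subvP => z za.
have : [vsval (killing_sharp a), z] \in k.
  by rewrite bracketNC rpredN bracket_levi_ideal //; apply: inl za.
by rewrite (rootspaceP _ _ za) -wformE rpredZeq (negPf (wform_root_neq0 aD)).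
Qed.

(** A nonzero bracket would lie in k, making a + xi a root of k above xi. The remaining case a + xi
    = 0 is excluded by coordinate j: alpha_j is a root of k, so xi has coefficient at least 1
    there. *)
Lemma highest_root_ideal_bracket0 xi j a x y :
  highest_root_in Delta Pi k xi -> (rootspace (tnth Pi j) <= k)%VS ->
  a \in roots_in Delta l -> a \in roots_in Delta bo ->
  x \in rootspace a -> y \in rootspace xi -> [x, y] = 0.
Proof.
move=> [xik max_xi] jk al /positive_rootP[aD nna] xa yxi; apply: contraTeq aD => nz.
have xl : x \in l by move: al; rewrite mem_filter => /andP[/subvP/(_ x xa)].
have yk : y \in k by move: xik; rewrite mem_filter => /andP[/subvP/(_ y yxi)].
have xyk := bracket_levi_ideal xl yk.
have xys := bracket_rootspace xa yxi.
have jr : tnth Pi j \in roots_in Delta k by rewrite mem_filter jk simple_root_mem.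
have := nonneg_coord j (max_xi _ jr).
rewrite linearB /= coord_simple eqxx subr_ge0 => xi1.
have := weight_of_vector xys nz; rewrite inE => /predU1P[s0|sD].
  have := congr1 (coord Pi j) s0; rewrite linearD linear0 /= => /eqP.
  rewrite gt_eqF // ltr_wpDl ?nonneg_coord //; exact: lt_le_trans xi1.
have : a + xi \in roots_in Delta k.
  by rewrite mem_filter sD andbT; apply: rootspace_sub_ideal sD xys nz xyk.
move/max_xi; rewrite opprD addrCA subrr addr0 => nnN.
suff -> : a = 0 by apply: zero_not_root.
apply: coord_simple_inj => i; rewrite linear0; apply/eqP; rewrite eq_le nonneg_coord // andbT.
by have := nonneg_coord i nnN; rewrite linearN oppr_ge0.
Qed.

End Levi.
End SimpleRoots.
End RootTheory.

(** * Existence of a composition factor that sees a given vector *)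

(* M is a submodule of least dimension containing v, and N a submodule of M of
   largest dimension avoiding v. *)
Lemma irr_constituent_containing (F : fieldType) (g : lieAlgebra F)
    (l : {vspace g}) (X : vectType F) (act : g -> X -> X) (W : {vspace X}) (v : X) :
  (forall x, act x 0 = 0) -> is_submodule l act W -> v \in W -> v != 0 ->
  exists M N, [/\ irr_constituent l act W M N, v \in M & v \notin N].
Proof.
move=> act0 subW vW nzv.
pose generating m := `[< exists M, [/\ is_submodule l act M, (M <= W)%VS, v \in M & \dim M = m] >].
have exM : exists m, generating m by exists (\dim W); apply/asboolP; exists W.
case: (ex_minnP exM) => m /asboolP[M [subM MW vM dimM]] minM.
pose avoiding m := `[< exists N, [/\ is_submodule l act N, (N <= M)%VS, v \notin N & \dim N = m] >].
have exN : exists m, avoiding m.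
  exists 0; apply/asboolP; exists 0%VS; split; rewrite ?sub0v ?dimv0 ?memv0 //.
  by move=> x w _; rewrite !memv0 => /eqP->; rewrite act0.
have leN k : avoiding k -> (k <= \dim M)%N.
  by move=> /asboolP[N [_ NM _ <-]]; apply: dimvS.
case: (ex_maxnP exN leN) => k /asboolP[N [subN NM vN dimN]] maxN.
exists M, N; split=> //; split=> //; first by rewrite NM.
  by move=> eNM; rewrite eNM vM in vN.
(* If P contains v, minimality of M gives P = M; if not, maximality of N gives P = N. *)
move=> P subP /andP[NP PM]; case vP: (v \in P); [right|left].
  apply/eqP; rewrite eqEdim PM dimM minM //; apply/asboolP.
  by exists P; split=> //; apply: subv_trans PM MW.
apply/eqP; rewrite eq_sym eqEdim NP dimN maxN //; apply/asboolP.
by exists P; rewrite vP.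
Qed.

(** * The tensor square as a Lie module *)

Section Tensor.
Variables (F : fieldType) (g : lieAlgebra F).
Implicit Types (x y z : g) (U V : {vspace g}).

Local Notation "[ x , y ]" := (bracket x y).

Lemma tensorDl x y z : tensor (x + y) z = tensor x z + tensor y z.
Proof. by apply/matrixP => i j; rewrite !mxE linearD mulrDl. Qed.

Lemma tensorDr x y z : tensor z (x + y) = tensor z x + tensor z y.
Proof. by apply/matrixP => i j; rewrite !mxE linearD mulrDr. Qed.

Lemma tensorZl c x z : tensor (c *: x) z = c *: tensor x z.
Proof. by apply/matrixP => i j; rewrite !mxE linearZ /= mulrA. Qed.

Lemma tensorZr c x z : tensor z (c *: x) = c *: tensor z x.
Proof. by apply/matrixP => i j; rewrite !mxE linearZ /= mulrCA. Qed.

Lemma tensor0l z : tensor 0 z = 0.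
Proof. by rewrite -(scale0r 0) tensorZl scale0r. Qed.

Lemma tensor0r z : tensor z 0 = 0.
Proof. by rewrite -(scale0r 0) tensorZr scale0r. Qed.

Lemma tensor_suml n (f : 'I_n -> g) z : tensor (\sum_i f i) z = \sum_i tensor (f i) z.
Proof. exact: (big_morph (fun x => tensor x z) (fun x y => tensorDl x y z) (tensor0l z)). Qed.

Lemma tensor_sumr n (f : 'I_n -> g) z : tensor z (\sum_i f i) = \sum_i tensor z (f i).
Proof. exact: (big_morph (tensor z) (fun x y => tensorDr x y z) (tensor0r z)). Qed.

Lemma tensor_neq0 x y : x != 0 -> y != 0 -> tensor x y != 0.
Proof.
move=> /coord_vbasis_neq0[i nzi] /coord_vbasis_neq0[j nzj].
by apply: contra_neq (mulf_neq0 nzi nzj) => /matrixP/(_ i j); rewrite !mxE.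
Qed.

Lemma mem_tensorv U V x y : x \in U -> y \in V -> tensor x y \in tensorv U V.
Proof.
move=> xU yV; rewrite (coord_vbasis xU) (coord_vbasis yV) tensor_suml rpred_sum // => i _.
rewrite tensor_sumr rpred_sum // => j _; rewrite tensorZl tensorZr !rpredZ // memv_span //.
by apply/allpairsP; exists ((vbasis U)`_i, (vbasis V)`_j); rewrite !mem_nth ?size_tuple.
Qed.

Lemma tensor_act_linear x : linear (tensor_act x).
Proof.
move=> c M N; rewrite /tensor_act scaler_sumr -big_split; apply: eq_bigr => i _ /=.
rewrite scaler_sumr -big_split; apply: eq_bigr => j _ /=.
by rewrite !mxE scalerDl scalerA.
Qed.

(** The action is defined through basis tensors; expanding y and z in the basis recovers the Leibniz
    rule on all pure tensors. *)
Lemma tensor_actE x y z : tensor_act x (tensor y z) = tensor [x, y] z + tensor y [x, z].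
Proof.
have -> : tensor [x, y] z = \sum_(i < \dim {:g}) \sum_(j < \dim {:g})
    tensor y z i j *: tensor [x, (vbasis {:g})`_i] (vbasis {:g})`_j.
  rewrite {1}(coord_vbasis (memvf y)) {1}(coord_vbasis (memvf z)) linear_sum tensor_suml.
  apply: eq_bigr => i _; rewrite linearZ /= tensorZl tensor_sumr scaler_sumr.
  by apply: eq_bigr => j _; rewrite tensorZr scalerA mxE.
have -> : tensor y [x, z] = \sum_(i < \dim {:g}) \sum_(j < \dim {:g})
    tensor y z i j *: tensor (vbasis {:g})`_i [x, (vbasis {:g})`_j].
  rewrite {1}(coord_vbasis (memvf y)) {1}(coord_vbasis (memvf z)) linear_sum tensor_suml.
  apply: eq_bigr => i _; rewrite tensorZl tensor_sumr scaler_sumr.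
  by apply: eq_bigr => j _; rewrite linearZ /= tensorZr scalerA mxE.
rewrite -big_split; apply: eq_bigr => i _; rewrite -big_split; apply: eq_bigr => j _.
by rewrite scalerDr.
Qed.

Lemma tensorv_submodule (l : {vspace g}) U V :
  (forall x y, x \in l -> y \in U -> [x, y] \in U) ->
  (forall x y, x \in l -> y \in V -> [x, y] \in V) ->
  is_submodule l (@tensor_act F g) (tensorv U V).
Proof.
move=> lU lV x w xl wUV.
suff sub : (linfun (tensor_act x) @: tensorv U V <= tensorv U V)%VS.
  by rewrite -(linfunE _ (tensor_act_linear x)); apply: (subvP sub); apply: memv_img.
rewrite limg_span; apply/span_subvP => _ /mapP[_ /allpairsP[[u v] /= [uU vV ->]] ->].
move: uU vV => /vbasis_mem uU /vbasis_mem vV.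
rewrite (linfunE _ (tensor_act_linear x)) tensor_actE.
by rewrite rpredD ?mem_tensorv ?lU ?lV.
Qed.

End Tensor.

(** * Nonvanishing of the Killing form *)

Import VectorInternalTheory.

(** The inverse is given by a pseudo-inverse matrix, whose value at the zero matrix is 0. This fixes
    what [wform] means should the Killing form vanish. *)
Lemma inv_lfun0 (F : fieldType) (U V : vectType F) : ((0 : 'Hom(U, V))^-1)%VF = 0.
Proof.
have f2mx0 : f2mx (0 : 'Hom(U, V)) = 0.
  rewrite -[X in f2mx X]/(linfun \0) unlock /=.
  by apply/matrixP => i j; rewrite !mxE /= linear0 mxE.
apply/lfunP => v; rewrite zero_lfunE unlock /= f2mx0 /pinvmx mxrank0 pid_mx_0.
by rewrite mulmx0 mul0mx mulmx0 linear0.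
Qed.

(** With a zero Killing form, [killing_flat] and its pseudo-inverse vanish, so every t_b, and with
    it every Cartan integer, would be 0. *)
Lemma cartan_int_killing_neq0 (F : fieldType) (g : lieAlgebra F) (h : {vspace g})
    (a b : weight h) :
  cartan_int a b != 0 -> exists x y : g, killing x y != 0.
Proof.
move=> nz; apply: contrapT => no; case/eqP: nz.
have k0 (x y : g) : killing x y = 0.
  by apply/eqP; apply: contra_notT no => nz; exists x, y.
have flat0 : killing_flat h = 0.
  apply/lfunP => s; apply/lfunP => t; rewrite !zero_lfunE.
  by rewrite killing_flatE k0.
rewrite /cartan_int /wform flat0.
rewrite (@inv_lfun0 F (subvs_of h) 'Hom(subvs_of h, F^o)).
by rewrite zero_lfunE /weight_val linear0 mulr0 mul0r.
Qed.

(** * The constituent of highest weight xi + gamma, and why it is not special *)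

Section HighestConstituent.
Variables (F : numFieldType) (g : lieAlgebra F) (b h : {vspace g}).
Variables (Delta : seq (weight h)) (n : nat) (Pi : n.-tuple (weight h)).
Variables (q j : 'I_n) (mu gamma xi : weight h) (k : {vspace g}).
Local Notation l := (levi Delta Pi q).

Hypothesis h_cartan : is_cartan h.
Hypothesis killing_nondeg : forall x : g, (forall y, killing x y = 0) -> x = 0.
Hypothesis Delta_roots : is_root_set Delta.
Hypothesis Pi_simple : is_simple_roots Delta Pi b.
Hypothesis gamma_highest : highest_root_in Delta Pi fullv gamma.
Hypothesis k_ideal : is_ideal (lie_prod l l) k.
Hypothesis k_simple : is_simple k.
Hypothesis simple_root_k : (rootspace (tnth Pi j) <= k)%VS.
Hypothesis xi_highest : highest_root_in Delta Pi k xi.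

Lemma highest_root_in_mem : xi \in Delta /\ (rootspace xi <= k)%VS.
Proof. by case: xi_highest; rewrite mem_filter => /andP[]. Qed.

Lemma highest_tensor_constituent (zn := lie_center (nilradical b Delta Pi q)) :
  exists M N : {vspace tensor_space g},
    irr_constituent l (@tensor_act _ g) (tensorv k zn) M N
    /\ highest_weight b l Delta (@tensor_act _ g) M N (xi + gamma).
Proof.
have [xiD xik] := highest_root_in_mem.
have [x xr nzx] := root_vector Delta_roots xiD.
have [y yr nzy] := root_vector Delta_roots (highest_root_mem gamma_highest).
have act0 u : tensor_act u (0 : tensor_space g) = 0.
  by rewrite -(linfunE _ (tensor_act_linear u)) linear0.
have subW : is_submodule l (@tensor_act _ g) (tensorv k zn).
  apply: tensorv_submodule => u v.
    exact: (bracket_levi_ideal h_cartan Delta_roots Pi_simple k_ideal k_simple).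
  exact: (bracket_levi_center h_cartan Delta_roots Pi_simple).
have yz : y \in zn.
  exact: subvP (highest_rootspace_center Delta_roots Pi_simple gamma_highest q) y yr.
have vW : tensor x y \in tensorv k zn := mem_tensorv (subvP xik x xr) yz.
have [M [N [irrMN vM vN]]] := irr_constituent_containing act0 subW vW (tensor_neq0 nzx nzy).
(* The tensor of highest root vectors satisfies the weight and annihilation conditions exactly,
   hence also modulo N. *)
exists M, N; split=> //; exists (tensor x y); split=> // [s|a u al ab ua].
  rewrite tensor_actE (rootspaceP _ _ xr) (rootspaceP _ _ yr) tensorZl tensorZr.
  by rewrite -scalerDl weight_valD subrr mem0v.
rewrite tensor_actE (highest_bracket0 Delta_roots Pi_simple gamma_highest q ab ua yr).
rewrite (highest_root_ideal_bracket0 h_cartan killing_nondeg Delta_roots Pi_simple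
  k_ideal k_simple xi_highest simple_root_k al ab ua xr).
by rewrite tensor0l tensor0r addr0 mem0v.
Qed.

Lemma highest_sum_not_special :
  wform gamma (tnth Pi j) <> 0 ->
  (forall i, wform gamma (tnth Pi i) <> 0 -> i = j) ->
  highest_weight b l Delta (@bracket _ g) (grade1 Delta Pi q) 0%VS mu ->
  ~ special Delta (grade1 Delta Pi q) mu gamma (xi + gamma).
Proof.
move=> j_nonorth j_unique [v [vg1 nzv v_mu _]] [_ [eps eps_g1 sum_eq]].
have [xiD xik] := highest_root_in_mem.
rewrite memv0 in nzv; move: vg1 eps_g1; rewrite grade1_weight_sum => vg1 eps_g1.
have [epsD eps1] : eps \in Delta /\ coord Pi q eps = 1.
  move: eps_g1; rewrite mem_filter => /andP[/subvP sub epsD]; split=> //.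
  have [x xr nzx] := root_vector Delta_roots epsD.
  exact/eqP/(weight_sum_weight h_cartan killing_nondeg xr nzx (sub x xr)).
(* A nonzero vector of g(1) of weight mu forces the alpha_q-coefficient of mu to be 1; then mu is
   not 0, so it is a root. *)
have [muD mu1] : mu \in Delta /\ coord Pi q mu = 1.
  have vmu : v \in rootspace mu.
    by apply/rootspaceP => s; apply/eqP; rewrite -subr_eq0 -memv0 v_mu.
  have /eqP mu1 := weight_sum_weight h_cartan killing_nondeg vmu nzv vg1.
  split=> //; have := weight_of_vector Delta_roots vmu nzv; rewrite inE => /predU1P[mu0|//].
  by have /eqP := mu1; rewrite mu0 linear0 eq_sym oner_eq0.
have xi0 : coord Pi q xi = 0.
  have [x xr nzx] := root_vector Delta_roots xiD.
  have := subvP (ideal_sub_levi h_cartan Delta_roots Pi_simple k_ideal) x (subvP xik x xr).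
  rewrite (levi_weight_sum h_cartan Pi_simple).
  by move=> /(weight_sum_weight h_cartan killing_nondeg xr nzx)/eqP.
(* The coefficient 2 is read off the supposed equality xi + gamma = mu + eps, as xi is a root of l
   and contributes 0. *)
have gamma2 : coord Pi q gamma = 2.
  by have := congr1 (coord Pi q) sum_eq; rewrite !linearD /= xi0 mu1 eps1 add0r.
have neq_gamma a : coord Pi q a = 1 -> a != gamma.
  move=> a1; apply/eqP => ac; have /eqP := a1; rewrite ac gamma2.
  by rewrite (eqr_nat _ 2 1).
have xi1 : 1 <= coord Pi j xi.
  have j_in : tnth Pi j \in roots_in Delta k.
    by rewrite mem_filter simple_root_k (simple_root_mem Pi_simple).
  have [_ /(_ _ j_in)/(nonneg_coord j)] := xi_highest.
  by rewrite linearB /= (coord_simple Pi_simple) eqxx subr_ge0.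
have := highest_root_sum_neq h_cartan killing_nondeg Delta_roots Pi_simple gamma_highest
  j_unique j_nonorth xi1 muD epsD (neq_gamma _ mu1) (neq_gamma _ eps1).
by rewrite sum_eq eqxx.
Qed.

End HighestConstituent.

Theorem lemma6p10 (R : realType) (g : lieAlgebra R[i]) (b h : {vspace g})
    (Delta : seq (weight h)) (T : dynkin)
    (Pi : (dynkin_rank T).-tuple (weight h)) (q : 'I_(dynkin_rank T))
    (mu gamma : weight h) (j0 : 'I_(dynkin_rank T)) (l_gamma : {vspace g})
    (xi_gamma : weight h)
    (l := levi Delta Pi q) (n := nilradical b Delta Pi q)
    (g1 := grade1 Delta Pi q) (zn := lie_center n)
    (g_simple : is_simple (fullv : {vspace g}))
    (h_cartan : is_cartan h)
    (b_borel : is_borel b)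
    (sub_hb : (h <= b)%VS)
    (Delta_roots : is_root_set Delta)
    (Pi_simple : is_simple_roots Delta Pi b)
    (T_type : has_type Pi)
    (q_listed : listed_type T q.+1)
    (q_quasi_heisenberg : quasi_heisenberg b Delta Pi q)
    (mu_highest : highest_weight b l Delta (@bracket _ g) g1 0%VS mu)
    (gamma_highest : highest_root_in Delta Pi fullv gamma)
    (j0_nonorth : wform gamma (tnth Pi j0) <> 0)
    (j0_unique : forall j, wform gamma (tnth Pi j) <> 0 -> j = j0)
    (l_gamma_ideal : is_ideal (lie_prod l l) l_gamma)
    (l_gamma_simple : is_simple l_gamma)
    (l_gamma_j0 : (rootspace (tnth Pi j0) <= l_gamma)%VS)
    (xi_highest : highest_root_in Delta Pi l_gamma xi_gamma) :
  (exists M N : {vspace tensor_space g},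
     irr_constituent l (@tensor_act _ g) (tensorv l_gamma zn) M N
     /\ highest_weight b l Delta (@tensor_act _ g) M N (xi_gamma + gamma))
  /\ ~ special Delta g1 mu gamma (xi_gamma + gamma).
Proof.
(* The diagonal entry 2 of the Cartan matrix at q is a nonzero Cartan integer, so the Killing form
   does not vanish. *)
have nondeg : forall x : g, (forall y, killing x y = 0) -> x = 0.
  apply: (killing_nondegenerate g_simple).
  apply: (@cartan_int_killing_neq0 _ _ _ (tnth Pi q) (tnth Pi q)).
  by rewrite T_type /cartan_entry eqxx intr_eq0.
split.
  exact: (highest_tensor_constituent h_cartan nondeg Delta_roots Pi_simple
            gamma_highest l_gamma_ideal l_gamma_simple l_gamma_j0 xi_highest).
exact: (highest_sum_not_special h_cartan nondeg Delta_roots Pi_simple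
          gamma_highest l_gamma_ideal l_gamma_j0 xi_highest
          j0_nonorth j0_unique mu_highest).
Qed.
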